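(* Let $c\ge 1$, let $n_1\geq n_2\geq\cdots\geq n_c$ be arbitrary positive integers, and let $G$ be a graph on $n\geq n_1+\sum_{i=1}^{c}(n_i-1)+1$ vertices with minimum degree $\delta(G)\geq\sum_{i=1}^{c}(n_i-1)+1$. Then $$G\rightarrow(n_1K_2,n_2K_2,\ldots,n_cK_2).$$
   Context: All graphs are finite, simple and undirected. $nK_2$ denotes a matching of size $n$, i.e. $n$ pairwise disjoint edges. For graphs $G,G_1,\ldots,G_m$, the notation $G\rightarrow(G_1,\ldots,G_m)$ means: whenever the edges of $G$ are partitioned into $m$ disjoint (possibly empty) color classes giving graphs $H_1,\ldots,H_m$, at least one $H_i$ contains a subgraph isomorphic to $G_i$. *)

(* Defs.v *)
From mathcomp Require Import all_boot.

Set Implicit Arguments.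
Unset Strict Implicit.
Unset Printing Implicit Defensive.

(* Finite simple undirected graphs with vertex set T. *)
Record sgraph (T : finType) := SGraph {
  edge : rel T;
  edge_sym : symmetric edge;
  edge_irr : irreflexive edge
}.

Definition deg (T : finType) (G : sgraph T) (x : T) : nat :=
  #|[set y | edge G x y]|.

(* Every degree is smaller than #|T|, so the default value #|T| only matters
   when T is empty. *)
Definition min_deg (T : finType) (G : sgraph T) : nat :=
  \big[minn/#|T|]_(x : T) deg G x.

(* G has a (not necessarily induced) subgraph isomorphic to F. *)
Definition contains (T U : finType) (G : sgraph T) (F : sgraph U) : Prop :=
  exists f : U -> T,
    injective f /\ (forall u v : U, edge F u v -> edge G (f u) (f v)).

(* The classes H i may be empty; each of them is a spanning subgraph of G. *)
Definition edge_partition (T : finType) (G : sgraph T) (m : nat)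
    (H : 'I_m -> sgraph T) : Prop :=
  (forall x y : T, edge G x y <-> exists i : 'I_m, edge (H i) x y) /\
  (forall (i j : 'I_m) (x y : T),
     edge (H i) x y -> edge (H j) x y -> i = j).

(* G -> (F_1, ..., F_m) *)
Definition arrows (T : finType) (G : sgraph T) (m : nat)
    (U : 'I_m -> finType) (F : forall i : 'I_m, sgraph (U i)) : Prop :=
  forall H : 'I_m -> sgraph T,
    edge_partition G H -> exists i : 'I_m, contains (H i) (F i).

(* n K_2: the i-th edge joins (i, false) and (i, true). *)
Definition matching_rel (n : nat) : rel ('I_n * bool) :=
  [rel u v | (u.1 == v.1) && (u.2 != v.2)].

Lemma matching_sym (n : nat) : symmetric (@matching_rel n).
Proof. by move=> u v; rewrite /matching_rel /= [u.1 == _]eq_sym [u.2 == _]eq_sym. Qed.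

Lemma matching_irr (n : nat) : irreflexive (@matching_rel n).
Proof. by move=> u; rewrite /matching_rel /= !eqxx. Qed.

Definition matching_graph (n : nat) : sgraph ('I_n * bool)%type :=
  SGraph (@matching_sym n) (@matching_irr n).

(* Main.v *)
Require Import Defs.
From mathcomp Require Import all_boot zify.

Set Implicit Arguments.
Unset Strict Implicit.
Unset Printing Implicit Defensive.

(** Write m_i = n_i - 1, S for the sum of the m_i and M for the largest m_i.
    Assume that no colour class H_i has m_i + 1 disjoint edges.

    The proof rests on a closure in the style of Bondy and Chvatal: if x and y
    are not adjacent in H_i and d_i(x) + d_i(y) > 2 m_i, then adding the edge xy
    to H_i creates no matching of size m_i + 1 ([has_matching_high_degree_sum]).
    So every colour class can be enlarged until d_i(x) + d_i(y) <= 2 m_i for all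
    its non-adjacent pairs; the classes may then overlap, which does no harm.
    Two vertices not adjacent in any enlarged class would have total degree at
    most 2 S in G, against a minimum degree of at least S + 1. Hence the enlarged
    classes cover all pairs of vertices, and it remains to treat a complete
    graph on N >= M + S + 2 vertices, which is the theorem of Cockayne and
    Lorimer ([cockayne_lorimer]).

    That theorem is proved by induction on S. If some vertex v has
    d_i(v) > 2 m_i, then H_i without v has no matching of size m_i, since such a
    matching would leave a neighbour of v uncovered; so v can be deleted while
    m_i drops by one. Otherwise close the classes again. Let m_i + e be the largest
    degree in H_i, attained at v, and assume e > 0. The m_i + e + 1 vertices
    equal or adjacent to v have degree at most m_i + e, and by closure all the
    others have degree at most m_i - e ([closed_degree_sum]). Summing these
    bounds over all colours gives fewer than the N (N - 1) ordered pairs that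
    have to be covered ([counting_contradiction]). *)

(** * Matchings inside a vertex set *)

(** Matchings are peeled off one edge at a time, and only vertex sets are
    shrunk, so that deleting vertices never changes the vertex type. The ends of
    an edge differ because the graphs are loopless. *)
Fixpoint has_matching (T : finType) (G : sgraph T) (A : {set T}) k : bool :=
  if k is k'.+1 then
    [exists x in A, exists y in A,
       edge G x y && has_matching G (A :\: [set x; y]) k']
  else true.

Definition deg_in (T : finType) (G : sgraph T) (A : {set T}) x : nat :=
  #|[set y in A | edge G x y]|.

Lemma edge_neq (T : finType) (G : sgraph T) x y : edge G x y -> x != y.
Proof. by apply: contraTneq => ->; rewrite edge_irr. Qed.

Lemma has_matchingSP (T : finType) (G : sgraph T) (A : {set T}) k :
  reflect (exists x y, [/\ x \in A, y \in A, edge G x y &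
                           has_matching G (A :\: [set x; y]) k])
          (has_matching G A k.+1).
Proof.
apply: (iffP exists_inP) => [[x xA /exists_inP[y yA /andP[xy M]]]|].
  by exists x, y.
move=> [x [y [xA yA xy M]]]; exists x => //.
by apply/exists_inP; exists y => //; rewrite xy.
Qed.

Lemma has_matching_add_edge (T : finType) (G : sgraph T) (A : {set T}) x y k :
  x \in A -> y \in A -> edge G x y -> has_matching G (A :\: [set x; y]) k ->
  has_matching G A k.+1.
Proof. by move=> xA yA xy M; apply/has_matchingSP; exists x, y. Qed.

Lemma has_matching_sub (T : finType) (G : sgraph T) (A B : {set T}) k :
  A \subset B -> has_matching G A k -> has_matching G B k.
Proof.
elim: k A B => // k IHk A B sAB /has_matchingSP[x [y [xA yA xy M]]].
apply/has_matchingSP; exists x, y; split=> //; try exact: (subsetP sAB).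
by apply: IHk M; apply: setSD.
Qed.

Lemma has_matching_eq_in (T : finType) (G1 G2 : sgraph T) (A : {set T}) k :
  {in A &, edge G1 =2 edge G2} -> has_matching G1 A k = has_matching G2 A k.
Proof.
suff imp (G3 G4 : sgraph T) (B : {set T}) : {in B &, edge G3 =2 edge G4} ->
    has_matching G3 B k -> has_matching G4 B k.
  by move=> e; apply/idP/idP; apply: imp => // x y xA yA; rewrite e.
elim: k B => // k IHk B e /has_matchingSP[x [y [xA yA xy M]]].
apply: (has_matching_add_edge xA yA); first by rewrite -e.
by apply: IHk M => a b /setDP[aB _] /setDP[bB _]; apply: e.
Qed.

Lemma matching_contains (T : finType) (G : sgraph T) (A : {set T}) k :
  has_matching G A k -> contains G (matching_graph k).
Proof.
suff main : has_matching G A k -> exists g : 'I_k * bool -> T,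
    [/\ injective g, forall u, g u \in A &
        forall i, edge G (g (i, false)) (g (i, true))].
  move=> /main[g [g_inj _ gE]]; exists g; split=> // -[i a] [j b].
  move=> /andP[/= /eqP <-].
  by case: a b => [] [] // _; rewrite 1?edge_sym; apply: gE.
elim: k A => [|k IHk] A.
  have no0 : 'I_0 -> False by case.
  by move=> _; exists (fun u => match no0 u.1 with end); split=> [[[]]|[[]]|[]].
move=> /has_matchingSP[x [y [xA yA xy /IHk[g [g_inj gA gE]]]]].
have nxy := edge_neq xy.
(* The new edge takes index 0 and the old indices are shifted by one. *)
pose g' (u : 'I_k.+1 * bool) :=
  if unlift ord0 u.1 is Some j then g (j, u.2) else if u.2 then y else x.
have gN u : (g u != x) * (g u != y) * (g u \in A).
  by have:= gA u; rewrite !inE negb_or => /andP[/andP[-> ->] ->].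
exists g'; split.
- move=> [i a] [j b]; rewrite /g' /=.
  case: unliftP => [i' ->|->]; case: unliftP => [j' ->|->].
  + by move=> /g_inj[-> ->].
  + by move: (gN (i', a)); case: b => -[[/eqP + /eqP +] _].
  + by move: (gN (j', b)); case: a => -[[/eqP + /eqP +] _] => ? ? /esym.
  + by case: a b => [] [] // /eqP; rewrite 1?[y == x]eq_sym (negPf nxy).
- move=> [i a]; rewrite /g' /=; case: unliftP => [j _|_]; first by rewrite gN.
  by case: a.
- by move=> i; rewrite /g' /=; case: unliftP => [j _|_].
Qed.

(** * Degree conditions that extend a matching *)

Lemma deg_in_pair (T : finType) (G : sgraph T) (A : {set T}) x y v :
  x != y -> x \in A -> y \in A ->
  deg_in G A v = edge G v x + edge G v y + deg_in G (A :\: [set x; y]) v.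
Proof.
move=> nxy xA yA; rewrite /deg_in (cardsD1 x) (cardsD1 y) !inE xA yA /=.
rewrite eq_sym nxy /= addnA; congr (_ + _); apply: eq_card => z.
by rewrite !inE negb_or; case: (z == x); case: (z == y).
Qed.

Lemma deg_in_gt0 (T : finType) (G : sgraph T) (A : {set T}) v :
  reflect (exists2 x, x \in A & edge G v x) (0 < deg_in G A v).
Proof.
apply: (iffP card_gt0P) => [[x]|[x xA vx]]; last by exists x; rewrite inE xA.
by rewrite inE => /andP[xA vx]; exists x.
Qed.

(** A matching of size k covers only 2k vertices, so v keeps a free neighbour.
    The induction on k removes one matching edge, which lowers the degree of v by
    at most two. *)
Lemma has_matching_high_degree (T : finType) (G : sgraph T) (A : {set T}) v k :
  v \in A -> 2 * k < deg_in G A v -> has_matching G (A :\ v) k ->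
  has_matching G A k.+1.
Proof.
elim: k A => [|k IHk] A vA dv.
  case/deg_in_gt0: dv => x xA vx _.
  exact: has_matching_add_edge vx _.
case/has_matchingSP=> x [y [/setD1P[xv xA] /setD1P[yv yA] xy M]].
apply: (has_matching_add_edge xA yA xy); apply: IHk.
- by rewrite !inE negb_or ![v == _]eq_sym xv yv.
- move: dv; rewrite (deg_in_pair _ _ (edge_neq xy) xA yA).
  by clear; case: (edge G v x) (edge G v y) => [] []; lia.
- by rewrite setDDl setUC -setDDl.
Qed.

(** The closure step: among the k matching edges, one is met by three edges from
    u and v, and can be replaced by two, or else u or v has a neighbour that the
    matching does not cover. *)
Lemma has_matching_high_degree_sum (T : finType) (G : sgraph T) (A : {set T})
    u v k :
  u \in A -> v \in A -> u != v -> ~~ edge G u v ->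
  2 * k < deg_in G A u + deg_in G A v ->
  has_matching G (A :\: [set u; v]) k -> has_matching G A k.+1.
Proof.
move=> + + uv nuv; elim: k A => [|k IHk] A uA vA duv.
  have: (0 < deg_in G A u) || (0 < deg_in G A v) by lia.
  by case/orP=> /deg_in_gt0[x xA ux] _; apply: has_matching_add_edge ux _.
case/has_matchingSP=> x [y [/setDP[xA xuv] /setDP[yA yuv] xy M]].
move: xuv yuv; rewrite !inE !negb_or => /andP[xu xv] /andP[yu yv].
(* If u is adjacent to one end of the matching edge xy and v to the other end,
   the path through u, x, y, v is augmenting. *)
have augment a b : a != b -> a \in A -> b \in A ->
    a != u -> a != v -> b != u -> b != v ->
    has_matching G (A :\: [set u; v] :\: [set a; b]) k ->
    edge G u a -> edge G v b -> has_matching G A k.+2.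
  move=> ab aA bA au av bu bv Mab ua vb.
  apply: (has_matching_add_edge uA aA ua).
  apply: (@has_matching_add_edge _ _ _ v b); rewrite ?inE ?negb_or //.
  - by rewrite eq_sym uv eq_sym av.
  - by rewrite bu eq_sym ab.
  - apply: has_matching_sub Mab; apply/subsetP => z; rewrite !inE !negb_or.
    by move=> /andP[/andP[-> ->] /andP[/andP[-> ->] ->]].
have nxy := edge_neq xy.
case: (boolP (edge G u x && edge G v y)) => [/andP[]|nxy1].
  exact: augment.
case: (boolP (edge G u y && edge G v x)) => [/andP[]|nxy2].
  by apply: (augment y x); rewrite // 1?eq_sym // [[set y; x]]setUC.
(* Otherwise at most two edges join u and v to x and y, and xy can be removed. *)
apply: (has_matching_add_edge xA yA xy); apply: IHk.
- by rewrite !inE negb_or ![u == _]eq_sym xu yu.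
- by rewrite !inE negb_or ![v == _]eq_sym xv yv.
- move: duv nxy1 nxy2; rewrite !(deg_in_pair _ _ nxy xA yA).
  move: (edge G u x) (edge G u y) (edge G v x) (edge G v y).
  clear; move: (deg_in _ _ _) (deg_in _ _ _) => p q.
  by move=> [] [] [] [] //=; lia.
- by rewrite setDDl setUC -setDDl.
Qed.

(** * Degree closure *)

Definition add_edge_rel (T : finType) (G : sgraph T) (u v : T) : rel T :=
  [rel x y | edge G x y ||
     (u != v) && (((x == u) && (y == v)) || ((x == v) && (y == u)))].

Lemma add_edge_sym (T : finType) (G : sgraph T) u v :
  symmetric (add_edge_rel G u v).
Proof.
move=> x y; rewrite /add_edge_rel /= edge_sym orbC.
rewrite [in LHS]orbC; congr (_ || (_ && _)).
by rewrite orbC ![(x == _) && _]andbC.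
Qed.

Lemma add_edge_irr (T : finType) (G : sgraph T) u v :
  irreflexive (add_edge_rel G u v).
Proof.
move=> x; rewrite /add_edge_rel /= edge_irr /=.
apply/negP => /andP[uv /orP[] /andP[/eqP xu /eqP xv]];
  by rewrite -xu -xv eqxx in uv.
Qed.

Definition add_edge (T : finType) (G : sgraph T) (u v : T) : sgraph T :=
  SGraph (add_edge_sym G u v) (add_edge_irr G u v).

Lemma has_matching_del_edge (T : finType) (G : sgraph T) (A : {set T}) u v k :
  has_matching (add_edge G u v) A k.+1 ->
  has_matching G A k.+1 \/
  [/\ u \in A, v \in A & has_matching G (A :\: [set u; v]) k].
Proof.
elim: k A => [|k IHk] A /has_matchingSP[x [y [xA yA + M]]].
all: case/orP=> [xy|/andP[uv xyuv]].
- by left; apply: has_matching_add_edge xy _.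
- by right; case/orP: xyuv xA yA => /andP[/eqP-> /eqP->].
- case/IHk: M => [M|[]]; first by left; apply: has_matching_add_edge xy _.
  case/setDP=> uA uxy /setDP[vA vxy] M; right; split=> //.
  move: uxy vxy; rewrite !inE !negb_or => /andP[ux uy] /andP[vx vy].
  apply: (@has_matching_add_edge _ _ _ x y); rewrite ?inE ?negb_or //.
  + by rewrite ![x == _]eq_sym ux vx.
  + by rewrite ![y == _]eq_sym uy vy.
  + by rewrite setDDl setUC -setDDl.
- right; have uvxy : [set u; v] = [set x; y].
    by case/orP: xyuv => /andP[/eqP-> /eqP->]; rewrite 1?setUC.
  have [uA vA] : u \in A /\ v \in A.
    by case/orP: xyuv xA yA => /andP[/eqP-> /eqP->].
  split=> //; rewrite uvxy -(@has_matching_eq_in _ (add_edge G u v)) //.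
  move=> a b; rewrite -uvxy !inE !negb_or => /andP[/andP[au av] _] _.
  by rewrite /= /add_edge_rel /= (negPf au) (negPf av) andbF orbF.
Qed.

Definition degree_closed (T : finType) (G : sgraph T) (A : {set T}) m : Prop :=
  {in A &, forall x y, x != y -> ~~ edge G x y ->
     deg_in G A x + deg_in G A y <= 2 * m}.

(** Adding one offending pair at a time terminates, since the number of
    non-adjacent pairs decreases. *)
Lemma closure_exists (T : finType) (G : sgraph T) (A : {set T}) k :
  ~~ has_matching G A k.+1 ->
  exists G' : sgraph T,
    [/\ subrel (edge G) (edge G'), ~~ has_matching G' A k.+1 &
        degree_closed G' A k].
Proof.
have [p] := ubnP #|[set e : T * T | ~~ edge G e.1 e.2]|.
elim: p G => // p IHp G ltp nM.
pose bad (e : T * T) := [&& e.1 \in A, e.2 \in A, e.1 != e.2, ~~ edge G e.1 e.2 &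
  2 * k < deg_in G A e.1 + deg_in G A e.2].
case: (pickP bad) => [[u v] /and5P[/= uA vA uv nuv duv]|none]; last first.
  exists G; split=> // x y xA yA xy nxy; rewrite leqNgt.
  by have := none (x, y); rewrite /bad /= xA yA xy nxy /= => ->.
have nM' : ~~ has_matching (add_edge G u v) A k.+1.
  apply: contra nM => /has_matching_del_edge[//|[_ _]].
  exact: has_matching_high_degree_sum.
have [|G' [sG nG' cG']] := IHp (add_edge G u v) _ nM'.
  rewrite -ltnS; apply: leq_trans ltp; rewrite ltnS; apply: proper_card.
  apply/properP; split.
    by apply/subsetP => e; rewrite !inE negb_or => /andP[].
  by exists (u, v); rewrite !inE //= /add_edge_rel /= uv !eqxx !orbT.
by exists G'; split=> // x y xy; apply: sG; rewrite /= /add_edge_rel /= xy.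
Qed.

(** Let m + e be the largest degree. The closed neighbourhood B of a vertex of
    that degree has m + e + 1 elements, all of degree at most m + e; the vertices
    outside B have degree at most m - e. The bound
    (m + e + 1) (m + e) + (N - m - e - 1) (m - e), where N is the size of A, is
    written below with e N on the left, to stay clear of subtraction. *)
Lemma closed_degree_sum (T : finType) (G : sgraph T) (A : {set T}) m :
  {in A, forall x, deg_in G A x <= 2 * m} ->
  degree_closed G A m ->
  exists2 e, e <= m &
    \sum_(x in A) deg_in G A x + e * #|A| <= #|A| * m + 2 * (e * (m + e).+1).
Proof.
move=> degle closed.
(* If no degree exceeds m, then e = 0 will do. *)
case: (pickP [pred x in A | m < deg_in G A x]) => [x0 /andP[x0A mx0]|small];
    last first.
  exists 0; rewrite // !mul0n !addn0 -sum_nat_const; apply: leq_sum => x xA.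
  by rewrite leqNgt; have := small x; rewrite /= xA /= => ->.
have [v vA vmax] := arg_maxnP (deg_in G A) x0A.
have mv : m < deg_in G A v := leq_trans mx0 (vmax _ x0A).
pose e := deg_in G A v - m; have dv : deg_in G A v = m + e by lia.
exists e; first by have := degle v vA; lia.
pose B := v |: [set y in A | edge G v y].
have sBA : B \subset A.
  by apply/subsetP => x; rewrite !inE => /orP[/eqP->|/andP[]].
have cB : #|B| = (m + e).+1 by rewrite cardsU1 !inE edge_irr andbF -dv.
have cA : #|A| = (m + e).+1 + #|A :\: B|.
  by rewrite -cB -(cardsID B A) (setIidPr sBA).
rewrite (big_setID B) (setIidPr sBA) /=.
have inB : \sum_(x in B) deg_in G A x <= #|B| * (m + e).
  rewrite -sum_nat_const -dv; apply: leq_sum => x xB.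
  by apply: vmax; apply: (subsetP sBA).
have outB : \sum_(x in A :\: B) deg_in G A x <= #|A :\: B| * (m - e).
  rewrite -sum_nat_const; apply: leq_sum => x.
  rewrite !inE negb_or => /andP[/andP[xv + ] xA]; rewrite xA /= => nvx.
  by have := closed v x vA xA; rewrite eq_sym xv dv => /(_ isT nvx); lia.
have em : e <= m by have := degle v vA; lia.
rewrite cA; rewrite cB in inB; nia.
Qed.

(** * Covering a complete graph *)

Lemma card_le_sum_deg_in (T I : finType) (H : I -> sgraph T)
    (A B : {set T}) x :
  B \subset A -> {in B, forall y, exists i, edge (H i) x y} ->
  #|B| <= \sum_i deg_in (H i) A x.
Proof.
move=> sBA cover.
apply: (@leq_trans #|\bigcup_i [set y in A | edge (H i) x y]|).
  apply: subset_leq_card; apply/subsetP => y yB; have [i xy] := cover y yB.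
  by apply/bigcupP; exists i; rewrite // inE (subsetP sBA).
rewrite /deg_in; elim/big_ind2: _ => [|C k D l Ck Dl|//]; first by rewrite cards0.
exact: leq_trans (leq_card_setU _ _) (leq_add Ck Dl).
Qed.

Lemma close_colours (T I : finType) (H : I -> sgraph T) (m : I -> nat)
    (A : {set T}) :
  (forall i, ~~ has_matching (H i) A (m i).+1) ->
  exists H' : I -> sgraph T, forall i,
    [/\ subrel (edge (H i)) (edge (H' i)), ~~ has_matching (H' i) A (m i).+1 &
        degree_closed (H' i) A (m i)].
Proof.
by move=> nM; exact: (fin_all_exists (fun i => closure_exists (nM i))).
Qed.

(** The difference of the two sides is at least
    (M + E + 1) (M + E + 2) - E (4 M + 2), which exceeds (M - E)^2. *)
Lemma counting_contradiction M S N E :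
  M + S + 2 <= N -> E <= S -> ~~ (N * N.-1 + E * N <= N * S + E * (4 * M + 2)).
Proof.
move=> leN leE; rewrite -ltnNge.
have -> : N * N.-1 + E * N = N * S + N * (N.-1 - S + E).
  by rewrite [E * N]mulnC -!mulnDr; congr (_ * _); lia.
rewrite ltn_add2l.
apply: (@leq_trans ((M + E + 2) * (M + 1 + E))); last by apply: leq_mul; lia.
have [+ _] := nat_Cauchy M E; rewrite -!mulnn; nia.
Qed.

(** The colour classes may overlap. This is what lets the closed classes of an
    incomplete graph be used here, and lets the classes be closed again at each
    step of the induction on the sum of the m_i. *)
Lemma cockayne_lorimer (T I : finType) (H : I -> sgraph T) (m : I -> nat) M
    (A : {set T}) :
  (forall i, m i <= M) -> M + \sum_i m i + 2 <= #|A| ->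
  {in A &, forall x y, x != y -> exists i, edge (H i) x y} ->
  exists i, has_matching (H i) A (m i).+1.
Proof.
have [p] := ubnP (\sum_i m i).
elim: p H m A => // p IHp H m A ltp leM cardA cover.
apply/existsP; apply: contraT => /existsPn nM.
have {H nM cover} [H closed cover] : exists2 H : I -> sgraph T,
    forall i, ~~ has_matching (H i) A (m i).+1 /\ degree_closed (H i) A (m i) &
    {in A &, forall x y, x != y -> exists i, edge (H i) x y}.
  have [H' H'P] := close_colours nM.
  exists H' => [i|x y xA yA xy]; first by have [_ ? ?] := H'P i.
  have [i ixy] := cover x y xA yA xy; exists i.
  by have [sub _ _] := H'P i; apply: sub.
have nM i : ~~ has_matching (H i) A (m i).+1 by case: (closed i).
(* A vertex with more than 2 m_i neighbours of colour i is deleted, at the cost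
   of one unit of m_i; the bound M need not change. *)
case: (pickP [pred vi : T * I | (vi.1 \in A) &&
                (2 * m vi.2 < deg_in (H vi.2) A vi.1)]) => [[v i]|low].
  move=> /andP[/= vA high].
  have nMv : ~~ has_matching (H i) (A :\ v) (m i).
    by apply: (contra _ (nM i)); apply: has_matching_high_degree vA high.
  have mi : 0 < m i by rewrite lt0n; apply: contraNneq nMv => ->.
  pose m' j := m j - (j == i).
  have sm : \sum_j m j = (\sum_j m' j).+1.
    rewrite (bigD1 i) //= [in RHS](bigD1 i) //= /m' eqxx.
    rewrite (eq_bigr (fun j => m j - (j == i))); first by lia.
    by move=> j /negPf ->; rewrite subn0.
  have [||||j] := IHp H m' (A :\ v).
  - by lia.
  - by move=> j; apply: leq_trans (leM j); apply: leq_subr.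
  - by move: cardA; rewrite (cardsD1 v A) vA sm; lia.
  - by move=> x y /setD1P[_ xA] /setD1P[_ yA]; apply: cover.
  rewrite /m'; case: eqP => [->|_]; first by rewrite subnSK // subn0 (negPf nMv).
  rewrite subn0 => /(has_matching_sub (subsetDl _ _)).
  by rewrite (negPf (nM j)).
have /fin_all_exists2[e em sume] : forall i, exists2 e, e <= m i &
    \sum_(x in A) deg_in (H i) A x + e * #|A|
      <= #|A| * m i + 2 * (e * (m i + e).+1).
  move=> i; apply: closed_degree_sum; last by case: (closed i).
  by move=> x xA; rewrite leqNgt; have := low (x, i); rewrite /= xA /= => ->.
(* Count the ordered pairs of adjacent vertices, with colours, in two ways. *)
have lower : #|A| * #|A|.-1 <= \sum_i \sum_(x in A) deg_in (H i) A x.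
  rewrite exchange_big /= -sum_nat_const; apply: leq_sum => x xA.
  rewrite (cardsD1 x A) xA /=; apply: card_le_sum_deg_in; first exact: subsetDl.
  by move=> y /setD1P[yx yA]; apply: cover; rewrite // eq_sym.
(* As e_i <= m_i <= M, each 2 (m_i + e_i + 1) is at most 4 M + 2. *)
pose E := \sum_i e i.
have upper : \sum_i \sum_(x in A) deg_in (H i) A x + E * #|A|
    <= #|A| * (\sum_i m i) + E * (4 * M + 2).
  rewrite /E !big_distrl big_distrr /= -!big_split /=; apply: leq_sum => i _.
  apply: leq_trans (sume i) _; rewrite leq_add2l.
  by have := leM i; have := em i; nia.
have ES : E <= \sum_i m i by apply: leq_sum.
have /negP[] := counting_contradiction cardA ES.
exact: leq_trans (leq_add lower (leqnn _)) upper.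
Qed.

(** * Graphs of large minimum degree *)

Lemma min_deg_le (T : finType) (G : sgraph T) x : min_deg G <= deg G x.
Proof.
rewrite /min_deg; have := mem_index_enum x.
elim: (index_enum T) => // y s IHs; rewrite inE big_cons geq_min.
by case/predU1P => [->|/IHs ->]; rewrite ?leqnn ?orbT.
Qed.

Theorem corollary1p4 (c : nat) (hc : 1 <= c) (n : 'I_c -> nat)
    (n_pos : forall i : 'I_c, 0 < n i)
    (n_noninc : forall i j : 'I_c, i <= j -> n j <= n i)
    (T : finType) (G : sgraph T)
    (hcard : n (Ordinal hc) + \sum_(i < c) (n i - 1) + 1 <= #|T|)
    (hdeg : \sum_(i < c) (n i - 1) + 1 <= min_deg G) :
  arrows G (fun i : 'I_c => matching_graph (n i)).
Proof.
move=> H [HG _]; pose m i := n i - 1.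
have mS i : n i = (m i).+1 by rewrite /m subn1 prednK.
suff /existsP[i M] : [exists i, has_matching (H i) [set: T] (m i).+1].
  by exists i; rewrite mS; apply: matching_contains M.
apply: contraT => /existsPn nM.
have [H' H'P] := close_colours nM.
have nM' i : ~~ has_matching (H' i) [set: T] (m i).+1 by case: (H'P i).
have deg_sum x : \sum_i m i < \sum_i deg_in (H' i) [set: T] x.
  have dG : \sum_i m i < deg G x.
    by rewrite -addn1; apply: leq_trans hdeg (min_deg_le G x).
  apply: leq_trans dG _; apply: card_le_sum_deg_in; first exact: subsetT.
  move=> y; rewrite inE => /HG[i xy]; exists i.
  by have [sub _ _] := H'P i; apply: sub.
have [||| i] := @cockayne_lorimer _ _ H' m (m (Ordinal hc)) [set: T].
- by move=> i; rewrite leq_sub2r // n_noninc.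
- rewrite cardsT; apply: leq_trans hcard.
  by rewrite [n (Ordinal hc)]mS addn1 addn2.
(* A pair missing from every closed class would have degree sum at most 2 S. *)
- move=> x y _ _ xy; apply/existsP; apply: contraT => /existsPn nadj.
  have: \sum_i (deg_in (H' i) [set: T] x + deg_in (H' i) [set: T] y)
         <= \sum_i 2 * m i.
    by apply: leq_sum => i _; have [_ _] := H'P i; apply; rewrite ?inE.
  rewrite big_split -big_distrr /=.
  move/(leq_trans (leq_add (deg_sum x) (deg_sum y))).
  by rewrite mul2n -addnn addSn addnS ltnNge leqnSn.
- by rewrite (negPf (nM' i)).
Qed.
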